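(* Let $\theta>0$ and, for $x>0$, let $X(t)=x-N_t$, where $N_t$ is a homogeneous Poisson process with intensity $\theta$ and $N_0=0$. Let $\tau(x)=\inf\{t>0: X(t)\le 0\}$ and $A(x)=\int_0^{\tau(x)}X(t)\,dt$. Then for all $\lambda_1,\lambda_2>0$ the joint Laplace transform of $(\tau(x),A(x))$ is $$E\left[e^{-\lambda_1\tau(x)-\lambda_2A(x)}\right]=\begin{cases}\theta^{x}\displaystyle\prod_{k=1}^{x}\frac{1}{\lambda_1+\lambda_2k+\theta} & \text{if } x\text{ is a positive integer},\\[3mm] \theta^{[x]+1}\displaystyle\prod_{k=0}^{[x]}\frac{1}{\lambda_1+\lambda_2(x-k)+\theta} & \text{if } x>0\text{ is not an integer}.\end{cases}$$
   Context: $[x]$ denotes the integer part of $x$. *)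

(* Defs.v *)
From HB Require Import structures.
From mathcomp Require Import all_boot all_order all_algebra.
From mathcomp Require Import all_classical all_reals all_analysis.

Set Implicit Arguments.
Unset Strict Implicit.
Unset Printing Implicit Defensive.

Import Order.TTheory GRing.Theory Num.Theory.
Import numFieldNormedType.Exports.

Local Open Scope classical_set_scope.
Local Open Scope ring_scope.

(* The product rule is only required of the whole (finite) family: taking some
   of the B i to be setT yields it for every subfamily. *)
Definition mutually_independent d d' (T : measurableType d)
    (T' : measurableType d') (R : realType) (P : probability T R)
    (I : finType) (X : I -> T -> T') : Prop :=
  forall B : I -> set T', (forall i, measurable (B i)) ->
    P (\bigcap_(i in [set: I]) (X i @^-1` B i)) =
    (\prod_(i : I) P (X i @^-1` B i))%E.

(* The truncated subtraction is exact for s <= t on nondecreasing paths. *)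
Definition increment d (T : measurableType d) (R : realType)
    (P : probability T R) (N : R -> {RV P >-> nat}) (s t : R) : T -> nat :=
  fun w => (N t w - N s w)%N.

(* N is unconstrained at negative times, which are never used. *)
Record poisson_process d (T : measurableType d) (R : realType)
    (P : probability T R) (theta : R) (N : R -> {RV P >-> nat}) : Prop := {
  pp_zero : forall w, N 0 w = 0%N ;
  pp_nondecreasing : forall w s t, 0 <= s -> s <= t -> (N s w <= N t w)%N ;
  pp_right_continuous : forall w t, 0 <= t ->
    ((N s w)%:R : R) @[s --> t^'+] --> ((N t w)%:R : R) ;
  pp_independent_increments : forall (n : nat) (t : nat -> R),
    0 <= t 0%N -> (forall i, (i < n)%N -> t i <= t i.+1) ->
    mutually_independent P (fun i : 'I_n => increment N (t i) (t i.+1)) ;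
  pp_poisson_increments : forall s t, 0 <= s -> s < t -> forall k : nat,
    P (increment N s t @^-1` [set k]) =
    (poisson_pmf (theta * (t - s)) k)%:E
}.

Section first_passage.
Context d (T : measurableType d) (R : realType) (P : probability T R).
Variables (N : R -> {RV P >-> nat}) (x : R).

Definition surplus (t : R) (w : T) : R := x - (N t w)%:R.

(* The infimum is +oo on paths that never reach ]-oo, 0]. *)
Definition passage_time (w : T) : \bar R :=
  ereal_inf [set t%:E | t in [set t : R | 0 < t /\ surplus t w <= 0]].

Definition passage_area (w : T) : \bar R :=
  (\int[lebesgue_measure]_(t in [set t : R | (0 <= t)%R /\ t%:E <= passage_time w])
     (surplus t w)%:E)%E.

(* 'E_P[_] takes real-valued functions only, hence the integral. Where the
   passage time is +oo, so is the area, and the integrand is expeR -oo = 0. *)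
Definition joint_laplace (l1 l2 : R) : \bar R :=
  (\int[P]_w expeR (- (l1%:E * passage_time w) - l2%:E * passage_area w))%E.

End first_passage.

(* Main.v *)
Require Import Defs.
From mathcomp Require Import all_boot all_order all_algebra.
From mathcomp Require Import all_classical all_reals all_analysis.
From mathcomp Require Import measurable_realfun ring lra.

(** The process is sampled on a grid of mesh [h]. If [c j] is the cost rate
    [l1 + l2 * (x - j)] while fewer than [m] = ceil(x) jumps have occurred and [0]
    afterwards, then [l1 * tau + l2 * A] is the integral of the nonincreasing
    function [c (N t)], so that left Riemann sums [S] approximate it from above
    within [h * c 0]. The numbers [V j], the product of [theta / (c k + theta)]
    over [j <= k < m], solve [(c j + theta) * V j = theta * V j.+1], which makes
    [exp (- S) * V N] a martingale up to an error [O(h^2)] per step. Hence its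
    mean after [M] steps is [V 0 + O(M h^2)]; and [V N = 1] unless
    [N (M h) < m], an event of probability [O(1 / (M h))]. The mesh [h = n^-2]
    and the horizon [M h = n] give the result as [n] tends to infinity. *)

Set Implicit Arguments.
Unset Strict Implicit.
Unset Printing Implicit Defensive.

Import Order.TTheory GRing.Theory Num.Theory.
Import numFieldNormedType.Exports.

Local Open Scope classical_set_scope.
Local Open Scope ring_scope.

(** No measurability is assumed: the integral of a nonnegative function is a supremum over the
    simple functions below it, which is monotone for any integrand. This allows the Laplace
    integrand to be bounded without showing that [passage_time] and [passage_area] are measurable in
    [w]. *)
Lemma ge0_le_integralT d (T : measurableType d) (R : realType)
    (mu : {measure set T -> \bar R}) (f g : T -> \bar R) :
  (forall t, 0 <= f t)%E -> (forall t, f t <= g t)%E ->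
  (\int[mu]_t f t <= \int[mu]_t g t)%E.
Proof.
move=> f0 fg; rewrite !ge0_integralTE//; last first.
  by move=> t; exact: le_trans (fg t).
apply: le_ereal_sup => _ [h hf <-]; exists h => // t.
exact: le_trans (fg t).
Qed.

(** * Riemann sums of nonincreasing functions *)

Section monotone_riemann_sum.
Context (R : realType) (f : R -> R).
Hypotheses (f_ni : nonincreasing_fun f) (f_ge0 : forall t, 0 <= f t).

Lemma integral_itv_nonincreasing (a b : R) : a <= b ->
  (((b - a) * f b)%:E <= \int[lebesgue_measure]_(t in `[a, b[) (f t)%:E
    <= ((b - a) * f a)%:E)%E.
Proof.
move=> ab.
have mf (D : set R) : measurable D -> measurable_fun D (fun t => (f t)%:E).
  by move=> mD; apply/measurable_EFinP; exact: nonincreasing_measurable.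
have cstE y : (((b - a) * y)%:E =
    \int[lebesgue_measure]_(t in `[a, b[) (cst y%:E) t)%E.
  rewrite integral_cst//= lebesgue_measure_itv/= lte_fin.
  case: ltgtP ab => // [_|->] _; last by rewrite subrr mul0r mule0.
  by rewrite -EFinB -EFinM mulrC.
apply/andP; split.
- rewrite cstE; apply: ge0_le_integral => //.
  + by move=> t _; rewrite lee_fin.
  + exact: mf.
  + move=> t /=; rewrite in_itv/= => /andP[_ tb]; rewrite lee_fin.
    exact/f_ni/ltW.
- rewrite [leRHS]cstE; apply: ge0_le_integral => //.
  + by move=> t _; rewrite lee_fin.
  + exact: mf.
  + move=> t /=; rewrite in_itv/= => /andP[at_ _]; rewrite lee_fin.
    exact: f_ni.
Qed.

Lemma nonincreasing_riemann_sum (h : R) (M : nat) : 0 <= h ->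
  ((h * \sum_(l < M) f (l.+1%:R * h))%:E <=
     \int[lebesgue_measure]_(t in `[0%R, (M%:R * h)%R[) (f t)%:E <=
     (h * \sum_(l < M) f (l%:R * h))%:E)%E.
Proof.
move=> h0; elim: M => [|M IH].
  by rewrite mul0r !big_ord0 mulr0 set_itvco0 integral_set0 lexx.
have Mh : 0 <= M%:R * h by rewrite mulr_ge0.
have MSh : M%:R * h <= M.+1%:R * h by rewrite ler_wpM2r// ler_nat.
have -> : `[0%R, (M.+1%:R * h)%R[%classic =
    `[0%R, (M%:R * h)%R[%classic `|` `[(M%:R * h)%R, (M.+1%:R * h)%R[%classic.
  by rewrite -itv_bndbnd_setU// bnd_simp.
rewrite ge0_integral_setU//=; last 3 first.
- apply/measurable_EFinP; apply: nonincreasing_measurable => //.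
  exact: measurableU.
- by move=> t _; rewrite lee_fin.
- apply/disj_setPS => t [] /=; rewrite !in_itv/= => /andP[_ t1] /andP[t2 _].
  by move: (lt_le_trans t1 t2); rewrite ltxx.
rewrite !big_ord_recr/= !mulrDr !EFinD.
have hE : M.+1%:R * h - M%:R * h = h by rewrite -addn1 natrD; ring.
have := integral_itv_nonincreasing MSh; rewrite hE.
case/andP: IH => IH1 IH2 /andP[J1 J2].
by rewrite !leeD.
Qed.

End monotone_riemann_sum.

(** * Passage time and area along one path, as the integral of a cost rate *)

Section passage_cost.
Context d (T : measurableType d) (R : realType) (P : probability T R).
Context (N : R -> {RV P >-> nat}) (x : R) (m : nat) (w : T).
Hypotheses (N_0 : N 0 w = 0%N)
  (N_nd : forall s t, 0 <= s -> s <= t -> (N s w <= N t w)%N)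
  (m_gt0 : (0 < m)%N) (mP : forall j : nat, (x <= j%:R) = (m <= j)%N).

Definition cost_rate (l1 l2 : R) (j : nat) : R :=
  if (j < m)%N then l1 + l2 * (x - j%:R) else 0.

Let passage_set := [set t%:E | t in [set t : R | 0 < t /\ surplus N x t w <= 0]].

Let passageP t : 0 <= t -> (m <= N t w)%N -> passage_set t%:E.
Proof.
move=> t0 mt; exists t => //; split; last by rewrite /surplus subr_le0 mP.
by rewrite lt_neqAle t0 andbT; apply/eqP => t0'; move: mt; rewrite -t0' N_0 leqNgt m_gt0.
Qed.

Lemma passage_time_ge0 : (0 <= passage_time N x w)%E.
Proof. by apply: le_ereal_inf_tmp => _ [t [t0 _] <-]; rewrite lee_fin ltW. Qed.

Lemma passage_time_le t : 0 <= t -> (m <= N t w)%N ->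
  (passage_time N x w <= t%:E)%E.
Proof. by move=> t0 mt; apply: ereal_inf_lbound; exact: passageP. Qed.

Lemma passage_time_lt t : (passage_time N x w < t%:E)%E -> (m <= N t w)%N.
Proof.
move=> /ereal_inf_lt[_ [s [s0 hs] <-]]; rewrite lte_fin => st.
move: hs; rewrite /surplus subr_le0 mP => /leq_trans; apply.
by apply: N_nd; exact: ltW.
Qed.

Lemma count_before_passage t : (0 <= t)%R -> (t%:E < passage_time N x w)%E ->
  (N t w < m)%N.
Proof.
by move=> t0; rewrite ltNge; apply: contraNltn; exact: passage_time_le.
Qed.

(** Freezing the path at its initial value on negative times makes it monotone on the whole line, as
    the measurability of monotone functions requires. *)
Let Nmax t := N (Num.max 0 t) w.

Let Nmax_nd s t : s <= t -> (Nmax s <= Nmax t)%N.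
Proof.
move=> st; apply: N_nd; first by rewrite le_max lexx.
by rewrite ge_max !le_max lexx st orbT.
Qed.

Let measurable_surplus (D : set R) : measurable D -> (forall t, D t -> 0 <= t) ->
  measurable_fun D (fun t => (surplus N x t w)%:E).
Proof.
move=> mD D0; apply/measurable_EFinP.
apply: (@eq_measurable_fun _ _ _ _ D (fun t => x - (Nmax t)%:R)).
  by move=> t /[!inE] /D0 t0; rewrite /surplus /Nmax max_r.
apply: nonincreasing_measurable => // s t st.
by rewrite lerD2l lerN2 ler_nat Nmax_nd.
Qed.

(** The endpoint [r] is a null set. Dropping it leaves only times strictly before passage, where the
    surplus is nonnegative; at [r] itself it can be negative when [x] is not an integer. *)
Lemma passage_area_fin (r : R) : passage_time N x w = r%:E ->
  (passage_area N x w =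
   \int[lebesgue_measure]_(t in `[0%R, r[) (surplus N x t w)%:E)%E.
Proof.
move=> tau; rewrite /passage_area tau.
have -> : [set t : R | 0 <= t /\ (t%:E <= r%:E)%E] = `[0, r]%classic.
  by apply/seteqP; split => t /=; rewrite in_itv/= lee_fin => /andP.
rewrite -integral_itv_bndo_bndc//; apply: measurable_surplus => // t /=.
by rewrite in_itv/= => /andP[].
Qed.

Lemma surplus_before_passage_ge0 t : 0 <= t -> (t%:E < passage_time N x w)%E ->
  0 <= surplus N x t w.
Proof.
move=> t0 /(count_before_passage t0).
by rewrite ltnNge -mP -ltNge /surplus subr_ge0 => /ltW.
Qed.

Lemma passage_area_ge0 : (0 <= passage_area N x w)%E.
Proof.
case tauE : (passage_time N x w) => [r| |].
- rewrite (passage_area_fin tauE); apply: integral_ge0 => s /=.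
  rewrite in_itv/= => /andP[s0 sr]; rewrite lee_fin.
  by apply: surplus_before_passage_ge0; rewrite ?tauE ?lte_fin.
- apply: integral_ge0 => s [s0 _]; rewrite lee_fin.
  by apply: surplus_before_passage_ge0; rewrite ?tauE ?ltry.
- by move: passage_time_ge0; rewrite tauE leNgt ltNyr.
Qed.

Section cost.
Context (l1 l2 : R).
Hypotheses (l1_gt0 : 0 < l1) (l2_gt0 : 0 < l2).

Lemma cost_rate_ge0 j : 0 <= cost_rate l1 l2 j.
Proof.
rewrite /cost_rate; case: ifPn => //; rewrite ltnNge -mP -ltNge => jx.
by rewrite addr_ge0 ?mulr_ge0 ?subr_ge0// ltW.
Qed.

Lemma cost_rate_ni i j : (i <= j)%N -> cost_rate l1 l2 j <= cost_rate l1 l2 i.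
Proof.
move=> ij; rewrite {1}/cost_rate; case: ifPn => [jm|_]; last exact: cost_rate_ge0.
rewrite /cost_rate (leq_ltn_trans ij jm) lerD2l ler_wpM2l ?(ltW l2_gt0)//.
by rewrite lerD2l lerN2 ler_nat.
Qed.

(** Before passage the cost rate equals [l1 + l2 * surplus], and after it the rate is 0. Having [m]
    jumps by time [t] makes the passage time finite and at most [t], so integrating up to [t]
    captures the whole cost. *)
Lemma passage_costE t : 0 <= t -> (m <= N t w)%N ->
  (l1%:E * passage_time N x w + l2%:E * passage_area N x w =
   \int[lebesgue_measure]_(s in `[0%R, t[) (cost_rate l1 l2 (N (Num.max 0 s) w))%:E)%E.
Proof.
move=> t0 mt; have := passage_time_ge0; have := passage_time_le t0 mt.
case tauE : (passage_time N x w) => [r| |]//; rewrite !lee_fin => rt r0.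
have f0 s : 0 <= cost_rate l1 l2 (Nmax s) by exact: cost_rate_ge0.
have mf (D : set R) : measurable D ->
    measurable_fun D (fun s => (cost_rate l1 l2 (Nmax s))%:E).
  move=> mD; apply/measurable_EFinP; apply: nonincreasing_measurable => // s u su.
  by apply: cost_rate_ni; exact: Nmax_nd.
have before s : `[0, r[%classic s -> 0 <= s /\ (s%:E < passage_time N x w)%E.
  by rewrite /= in_itv/= tauE lte_fin => /andP.
rewrite (passage_area_fin tauE).
have -> : `[0, t[%classic = `[0, r[%classic `|` `[r, t[%classic.
  by rewrite -itv_bndbnd_setU// bnd_simp.
rewrite ge0_integral_setU//=; last 3 first.
- by apply: mf; exact: measurableU.
- by move=> s _; rewrite lee_fin; exact: f0.
- apply/disj_setPS => s [] /=; rewrite !in_itv/= => /andP[_ t1] /andP[t2 _].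
  by move: (lt_le_trans t1 t2); rewrite ltxx.
(* The count is known to be at least [m] only strictly after [r], so the point [r] is removed before
   the integrand is shown to vanish. *)
rewrite [X in _ = (_ + X)%E](_ : _ = 0%E); last first.
  rewrite -integral_itv_obnd_cbnd; last exact: mf.
  apply: integral0_eq => s /=; rewrite in_itv/= => /andP[rs _].
  rewrite /cost_rate ifF//; apply/negbTE; rewrite -leqNgt max_r ?(le_trans r0 (ltW rs))//.
  by apply: passage_time_lt; rewrite tauE lte_fin.
have -> : (l1%:E * r%:E = \int[lebesgue_measure]_(s in `[0%R, r[) (cst l1%:E) s)%E.
  rewrite integral_cst//= lebesgue_measure_itv/= lte_fin.
  case: ltgtP r0 => // [_|<-] _; last by [].
  by rewrite oppr0 adde0.
rewrite -ge0_integralZl//; last 3 first.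
- by apply: measurable_surplus => // s /before[].
- by move=> s /before[s0 sr]; rewrite lee_fin surplus_before_passage_ge0.
- by rewrite lee_fin ltW.
rewrite adde0 -ge0_integralD//=; last 3 first.
- by move=> s _; rewrite lee_fin ltW.
- by move=> s /before[s0 sr]; apply: mule_ge0; rewrite lee_fin;
    [exact: ltW|exact: surplus_before_passage_ge0].
- apply: measurable_funeM; apply: measurable_surplus => // s.
  by move=> /before[].
apply: eq_integral => s /[!inE] /before[s0 sr].
by rewrite max_r// /cost_rate count_before_passage// EFinD EFinM.
Qed.

End cost.
End passage_cost.

(** * Exponential and Poisson estimates *)

Section real_estimates.
Context (R : realType).
Implicit Types y : R.

Lemma expRN_mul1D_le1 y : expR (- y) * (1 + y) <= 1.
Proof. by rewrite expRN mulrC ler_pdivrMr ?expR_gt0// mul1r expR_ge1Dx. Qed.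

Lemma expRN_mul1D_ge y : 0 <= y -> 1 - y ^+ 2 <= expR (- y) * (1 + y).
Proof.
move=> y0; have -> : 1 - y ^+ 2 = (1 - y) * (1 + y) by ring.
rewrite ler_wpM2r ?expR_ge1Dx//; lra.
Qed.

(** The exponential dominates the single term of degree [k.+1] of its series; dividing by that term
    leaves the factor [k.+1%:R / y]. *)
Lemma poisson_pmf_le y k : 0 < y -> poisson_pmf y k <= k.+1%:R / y.
Proof.
move=> y0; have f0 n : 0 < n`!%:R :> R by rewrite ltr0n fact_gt0.
have : y ^+ k.+1 / k.+1`!%:R <= expR y.
  by apply: le_trans (expR_ge1Dxn k (ltW y0)); rewrite lerDr.
rewrite /poisson_pmf y0 expRN ler_pdivrMr// factS natrM exprS => ye.
rewrite ler_pdivrMr ?expR_gt0// mulrAC ler_pdivlMr// mulrAC ler_pdivrMr//.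
by apply: le_trans (le_trans _ ye) _; rewrite ?[_ ^+ _ * _]mulrC// mulrA (mulrC _ (expR y)).
Qed.

(** * Mean effect of a single grid step *)

Section one_step.
Context (theta h c C V V' : R).
Hypotheses (theta_gt0 : 0 < theta) (h_gt0 : 0 < h) (c_ge0 : 0 <= c) (c_le : c <= C).
Hypotheses (V_ge0 : 0 <= V) (V_le1 : V <= 1) (VV' : (c + theta) * V = theta * V').

Local Notation p0 := (poisson_pmf (theta * h) 0).
Local Notation p1 := (poisson_pmf (theta * h) 1).
Local Notation u := (expR (- (h * c))).
Local Notation eps := (((theta + C) * h) ^+ 2).

Let a_gt0 : 0 < theta * h. Proof. exact: mulr_gt0. Qed.
Let p0E : p0 = expR (- (theta * h)).
Proof. by rewrite /poisson_pmf a_gt0 expr0 fact0 invr1 !mul1r. Qed.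
Let p1E : p1 = theta * h * expR (- (theta * h)).
Proof. by rewrite /poisson_pmf a_gt0 expr1 invr1 mulr1. Qed.
Let u_gt0 : 0 < u. Proof. exact: expR_gt0. Qed.
Let u_le1 : u <= 1.
Proof. by rewrite expR_le1 oppr_le0 mulr_ge0// ltW. Qed.

Lemma poisson_pmf01_le1 : p0 + p1 <= 1.
Proof. by rewrite p0E p1E; apply: le_trans (expRN_mul1D_le1 (theta * h)); lra. Qed.

(** A single [eps] serves twice: since [c <= C], it dominates the square of [theta * h], which
    bounds the probability of two or more jumps, and the square of [theta * h + h * c], which bounds
    the error in the mean. *)
Let p01_ge : 1 - eps <= p0 + p1.
Proof.
have -> : p0 + p1 = expR (- (theta * h)) * (1 + theta * h) by rewrite p0E p1E; ring.
apply: le_trans (expRN_mul1D_ge (ltW a_gt0)); rewrite lerD2l lerN2.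
have C0 := le_trans c_ge0 c_le; have t0 := ltW theta_gt0.
by rewrite ler_sqr ?nnegrE ?mulr_ge0 ?(ltW h_gt0) ?addr_ge0// ler_wpM2r ?(ltW h_gt0)// lerDl.
Qed.

Let p01_ge0 : 0 <= p0 + p1.
Proof. by rewrite addr_ge0// poisson_pmf_ge0. Qed.

(** The relation [VV'] trades [theta * V'] for [(c + theta) * V]. The first-order terms thus combine
    into [expR (- y) * (1 + y)] with [y = theta * h + h * c], which is within [y ^+ 2] of 1. *)
Let mean_step : u * (p0 * V + p1 * V') =
  expR (- (theta * h + h * c)) * (1 + (theta * h + h * c)) * V.
Proof.
rewrite opprD expRD p0E p1E.
have -> : u * (expR (- (theta * h)) * V + theta * h * expR (- (theta * h)) * V') =
  u * expR (- (theta * h)) * (V + h * (theta * V')) by ring.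
by rewrite -VV'; ring.
Qed.

(** Here [delta] is the error inherited from later steps; it is not amplified, because the
    discounted weights of zero and one jump sum to at most 1. Two or more jumps get the crude value
    1, at a cost of at most [eps]. *)
Lemma one_step_upper delta : 0 <= delta ->
  u * (p0 * (V + delta) + p1 * (V' + delta) + (1 - (p0 + p1))) <= V + (delta + eps).
Proof.
move=> d0.
have -> : u * (p0 * (V + delta) + p1 * (V' + delta) + (1 - (p0 + p1))) =
  u * (p0 * V + p1 * V') + u * (p0 + p1) * delta + u * (1 - (p0 + p1)) by ring.
rewrite mean_step [leRHS]addrA; apply: lerD; first apply: lerD.
- by rewrite ler_piMl// expRN_mul1D_le1.
- by rewrite ler_piMl// mulr_ile1 ?(ltW u_gt0)// poisson_pmf01_le1.
- apply: (@le_trans _ _ (1 - (p0 + p1))); last by move: p01_ge; lra.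
  by rewrite ler_piMl// subr_ge0 poisson_pmf01_le1.
Qed.

(** Two or more jumps get the value 0 here, and [eps] pays for the factor [1 - y ^+ 2] in the
    mean. *)
Lemma one_step_lower delta : 0 <= delta ->
  V - (delta + eps) <= u * (p0 * (V - delta) + p1 * (V' - delta)).
Proof.
move=> d0.
have -> : u * (p0 * (V - delta) + p1 * (V' - delta)) =
  u * (p0 * V + p1 * V') - u * (p0 + p1) * delta by ring.
rewrite mean_step [leLHS](_ : _ = V - eps - delta); last by ring.
apply: lerD; last first.
  by rewrite lerN2 ler_piMl// mulr_ile1 ?(ltW u_gt0)// poisson_pmf01_le1.
set y := theta * h + h * c.
have y0 : 0 <= y by rewrite addr_ge0 ?(ltW a_gt0)// mulr_ge0// ltW.
have ye : y ^+ 2 <= eps.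
  rewrite ler_sqr ?nnegrE//; last first.
    by rewrite mulr_ge0 ?(ltW h_gt0)// addr_ge0 ?(ltW theta_gt0)// (le_trans c_ge0).
  by rewrite /y (mulrC h) -mulrDl ler_wpM2r ?(ltW h_gt0)// lerD2l.
apply: (@le_trans _ _ ((1 - y ^+ 2) * V)); last by rewrite ler_wpM2r// expRN_mul1D_ge.
have : y ^+ 2 * V <= y ^+ 2 by rewrite ler_piMr// sqr_ge0.
lra.
Qed.

End one_step.
End real_estimates.

(** * The candidate transform and its recurrence *)

Section exit_transform.
Context (R : realType) (theta : R) (c : nat -> R) (m : nat).
Hypotheses (theta_gt0 : 0 < theta) (c_ge0 : forall j, 0 <= c j).

(** Each factor is the Laplace transform at [c k] of an exponential holding time of rate [theta], so
    the product is the transform of the total cost of climbing from [j] jumps to [m]. *)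
Definition exit_transform (j : nat) : R :=
  \prod_(j <= k < m) (theta / (c k + theta)).

Let factor_gt0 k : 0 < c k + theta. Proof. exact: ltr_wpDl. Qed.

Lemma exit_transform_ge0 j : 0 <= exit_transform j.
Proof. by apply: prodr_ge0 => k _; rewrite divr_ge0// ltW. Qed.

Lemma exit_transform_le1 j : exit_transform j <= 1.
Proof.
rewrite [leRHS](_ : 1 = \prod_(j <= k < m) 1); last by rewrite big1_eq.
apply: ler_prod => k _; rewrite divr_ge0 ?(ltW theta_gt0) ?(ltW (factor_gt0 k))//=.
by rewrite ler_pdivrMr// mul1r lerDr.
Qed.

Lemma exit_transform_out j : (m <= j)%N -> exit_transform j = 1.
Proof. by move=> mj; rewrite /exit_transform big_geq. Qed.

Lemma exit_transform_rec j : (j < m)%N ->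
  (c j + theta) * exit_transform j = theta * exit_transform j.+1.
Proof.
move=> jm; rewrite /exit_transform big_ltn// mulrA; congr (_ * _).
by rewrite mulrC divfK// gt_eqF.
Qed.

End exit_transform.

Lemma measurable_fun_nat d (T : measurableType d) d' (T' : measurableType d')
    (D : set T) (X : T -> nat) (g : nat -> T') :
  measurable_fun D X -> measurable_fun D (fun w => g (X w)).
Proof. by move=> mX; apply: (measurableT_comp (f := g)). Qed.

(** * The law of the process sampled on a grid *)

Section increments.
Context d (T : measurableType d) (R : realType) (P : probability T R).
Context (theta : R) (N : R -> {RV P >-> nat}).
Hypotheses (theta_gt0 : 0 < theta) (hN : poisson_process theta N).

Lemma measurable_increment s t (B : set nat) : measurable (increment N s t @^-1` B).
Proof.
rewrite -[X in measurable X]setTI; apply: measurable_fun_subn => //; exact: measurable_funPT.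
Qed.

Context (h : R).
Hypothesis h_gt0 : 0 < h.

(** These cylinder events stand in for conditioning on the past: integrating over one of them fixes
    the first [size s] increments. *)
Definition grid_increments (s : seq nat) : set T :=
  [set w | forall l, (l < size s)%N ->
     increment N (l%:R * h) (l.+1%:R * h) w = nth 0 s l].

Let increment_law l k :
  P (increment N (l%:R * h) (l.+1%:R * h) @^-1` [set k]) =
  (poisson_pmf (theta * h) k)%:E.
Proof.
rewrite (pp_poisson_increments hN) ?mulr_ge0 ?ltr_pM2r ?ltr_nat ?(ltW h_gt0)//.
by congr (poisson_pmf _ _)%:E; rewrite -addn1 natrD; ring.
Qed.

Lemma measurable_grid_increments s : measurable (grid_increments s).
Proof.
rewrite (_ : grid_increments s = \bigcap_(l in `I_(size s))
    (increment N (l%:R * h) (l.+1%:R * h) @^-1` [set nth 0 s l])).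
  apply: bigcap_measurableType => l _; exact: measurable_increment.
by apply/seteqP; split.
Qed.

Lemma probability_grid_increments s :
  P (grid_increments s) = (\prod_(k <- s) poisson_pmf (theta * h) k)%:E.
Proof.
have := pp_independent_increments hN (n := size s) (t := fun l => l%:R * h).
rewrite mul0r lexx => /(_ isT).
have -> : (forall i, (i < size s)%N -> i%:R * h <= i.+1%:R * h) = True.
  by apply/propext; split => // _ i _; rewrite ler_wpM2r ?ler_nat ?(ltW h_gt0).
move=> /(_ I (fun i => [set nth 0 s i])) /(_ (fun _ => I)).
rewrite [X in _ = X -> _](eq_bigr
  (fun i : 'I_(size s) => (poisson_pmf (theta * h) (nth 0 s i))%:E)); last first.
  by move=> i _; exact: increment_law.
rewrite prodEFin (big_nth 0) big_mkord => <-.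
congr (P _); apply/seteqP; split => w /= Hw; last first.
  by move=> l ls; exact: (Hw (Ordinal ls)).
by move=> i _; exact: Hw.
Qed.

Lemma grid_increments_rcons s k : grid_increments (rcons s k) =
  grid_increments s `&`
    increment N ((size s)%:R * h) ((size s).+1%:R * h) @^-1` [set k].
Proof.
apply/seteqP; split => w /=.
  move=> Hw; split => [l ls|]; first by rewrite Hw ?size_rcons ?ltnS 1?ltnW// nth_rcons ls.
  by rewrite Hw ?size_rcons// nth_rcons ltnn eqxx.
move=> [Hw wk] l; rewrite size_rcons ltnS leq_eqVlt nth_rcons.
by case: ltngtP => // [ls _|-> _]; [exact: Hw|].
Qed.

(** The increments telescope; monotone paths make the truncated subtraction exact. *)
Lemma grid_count s w : grid_increments s w -> N ((size s)%:R * h) w = sumn s.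
Proof.
elim/last_ind: s => [_|s k IH]; first by rewrite mul0r (pp_zero hN).
rewrite grid_increments_rcons => -[/IH Ns]; rewrite /= /increment => <-.
rewrite size_rcons sumn_rcons Ns subnKC// -Ns.
by apply: (pp_nondecreasing hN); rewrite ?mulr_ge0 ?ler_wpM2r ?ler_nat ?(ltW h_gt0).
Qed.

(** * Mean of the discounted exit transform on the grid *)

Section grid_functional.
Context (c : nat -> R) (m : nat) (C : R).
Hypotheses (c_ge0 : forall j, 0 <= c j) (c_le : forall j, c j <= C).
Hypothesis c_out : forall j, (m <= j)%N -> c j = 0.

(** The approximate martingale restarted at step [i] and run for [r] further steps. *)
Definition grid_functional (i r : nat) (w : T) : R :=
  expR (- (h * \sum_(i <= l < i + r) c (N (l%:R * h) w))) *
  exit_transform theta c m (N ((i + r)%:R * h) w).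

Lemma measurable_grid_functional i r : measurable_fun setT (grid_functional i r).
Proof.
apply: measurable_funM; last exact/measurable_fun_nat/measurable_funPT.
apply: measurableT_comp => //; apply: measurable_funN; apply: measurable_funM => //.
by apply: measurable_sum => l; exact/measurable_fun_nat/measurable_funPT.
Qed.

Lemma grid_functional_ge0 i r w : 0 <= grid_functional i r w.
Proof. by rewrite mulr_ge0 ?expR_ge0// exit_transform_ge0. Qed.

Lemma grid_functional_le1 i r w : grid_functional i r w <= 1.
Proof.
rewrite mulr_ile1 ?expR_ge0 ?exit_transform_ge0 ?exit_transform_le1//.
by rewrite expR_le1 oppr_le0 mulr_ge0 ?(ltW h_gt0)// sumr_ge0.
Qed.

Lemma grid_functional_out i r w :
  (m <= N (i%:R * h) w)%N -> grid_functional i r w = 1.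
Proof.
move=> mi; have later l : (i <= l)%N -> (m <= N (l%:R * h) w)%N.
  move=> il; apply: leq_trans mi _; apply: (pp_nondecreasing hN).
    by rewrite mulr_ge0// ltW.
  by rewrite ler_wpM2r ?ler_nat// ltW.
rewrite /grid_functional exit_transform_out ?later ?leq_addr//.
rewrite big_nat big1 ?mulr0 ?oppr0 ?expR0 ?mulr1// => l /andP[il _].
by rewrite c_out// later.
Qed.

Lemma grid_functionalS s r w : grid_increments s w ->
  grid_functional (size s) r.+1 w =
  expR (- (h * c (sumn s))) * grid_functional (size s).+1 r w.
Proof.
move=> /grid_count Ns; rewrite /grid_functional addSnnS big_ltn ?addnS ?ltnS ?leq_addr//.
by rewrite Ns mulrDr opprD expRD mulrA.
Qed.

Local Notation eps := (((theta + C) * h) ^+ 2).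
Local Notation p := (poisson_pmf (theta * h)).
Local Notation pr s := (\prod_(k <- s) p k).
Local Notation V := (exit_transform theta c m).

Let pr_ge0 s : 0 <= pr s.
Proof. by apply: prodr_ge0 => k _; exact: poisson_pmf_ge0. Qed.

Let pr_rcons s k : pr (rcons s k) = pr s * p k.
Proof. by rewrite -cats1 big_cat big_seq1. Qed.

Let prE s : P (grid_increments s) = (pr s)%:E.
Proof. exact: probability_grid_increments. Qed.

Let mE s : measurable (grid_increments s).
Proof. exact: measurable_grid_increments. Qed.

Let mG i r (D : set T) : measurable_fun D (fun w => (grid_functional i r w)%:E).
Proof. by apply/measurable_EFinP/measurable_funTS/measurable_grid_functional. Qed.

Let integral_grid_cst s (f : T -> R) (a : R) :
  (forall w, grid_increments s w -> f w = a) ->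
  (\int[P]_(w in grid_increments s) (f w)%:E = (pr s * a)%:E)%E.
Proof.
move=> fa; rewrite (eq_integral (cst a%:E)); last by move=> w /[!inE] /fa ->.
by rewrite integral_cst// [X in (_ * X)%E]prE -EFinM mulrC.
Qed.

(** Divided by [pr s], this says that the conditional mean given the past is [V] at the current
    count, with error at most [eps] per remaining step. The induction is on [r] for all words [s],
    since the next increment lengthens the word. *)
Lemma integral_grid_functional s r :
  ((pr s * (V (sumn s) - r%:R * eps))%:E <=
     \int[P]_(w in grid_increments s) (grid_functional (size s) r w)%:E <=
     (pr s * (V (sumn s) + r%:R * eps))%:E)%E.
Proof.
have eps0 : 0 <= eps by exact: sqr_ge0.
elim: r s => [|r IH] s.
  rewrite (@integral_grid_cst s _ (V (sumn s))) ?mul0r ?subr0 ?addr0 ?lexx// => w Ew.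
  by rewrite /grid_functional addn0 big_geq// mulr0 oppr0 expR0 mul1r (grid_count Ew).
(* The recurrence for [V] holds only below [m]; from [m] on the functional is identically 1. *)
have [ms|ms] := leqP m (sumn s).
  rewrite (@integral_grid_cst s _ 1); last first.
    by move=> w /grid_count Ns; rewrite grid_functional_out// Ns.
  rewrite exit_transform_out// !lee_fin.
  have rE : 0 <= r.+1%:R * eps by rewrite mulr_ge0.
  by apply/andP; split; apply: ler_wpM2l => //; lra.
set i := size s; set E := grid_increments s.
pose E0 := grid_increments (rcons s 0); pose E1 := grid_increments (rcons s 1).
(* The cylinder splits according to a next increment of 0, 1, or more. On [F] only the bounds 0 and
   1 on the functional are used, and the probability of [F] is found by subtraction. *)
pose F := E `&` increment N (i%:R * h) (i.+1%:R * h) @^-1` [set k | (1 < k)%N].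
have mF : measurable F by apply: measurableI; [exact: mE|exact: measurable_increment].
have EU : E = E0 `|` E1 `|` F.
  rewrite /E0 /E1 !grid_increments_rcons -!setIUr -[LHS]setIT; congr (_ `&` _).
  apply/seteqP; split => w //= _.
  by case: (increment _ _ _ w) => [|[|k]]; [left; left|left; right|right].
have dE : [disjoint E0 & E1].
  apply/disj_setPS => w []; rewrite /E0 /E1 !grid_increments_rcons.
  by move=> [_ /= ->] [_ /=].
have dF : [disjoint E0 `|` E1 & F].
  apply/disj_setPS => w []; rewrite /E0 /E1 !grid_increments_rcons.
  by move=> [] [_ /= w0] [_ /=]; rewrite w0.
set u := expR (- (h * c (sumn s))).
have G0 w : (0 <= (grid_functional i.+1 r w)%:E)%E.
  by rewrite lee_fin grid_functional_ge0.
have mU : measurable (E0 `|` E1) by apply: measurableU; exact: mE.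
have -> : (\int[P]_(w in E) (grid_functional i r.+1 w)%:E =
    u%:E * \int[P]_(w in E) (grid_functional i.+1 r w)%:E)%E.
  rewrite -(ge0_integralZl_EFin P (mE s) (fun w _ => G0 w) (@mG _ _ _) (expR_ge0 _)).
  by apply: eq_integral => w /[!inE] Ew; rewrite grid_functionalS// EFinM.
have PF : P F = (pr s * (1 - (p 0 + p 1)))%:E.
  have : P E = (P E0 + P E1 + P F)%E.
    rewrite EU measureU//; last by apply/eqP; rewrite -disj_set2E.
    rewrite measureU//; [exact: mE|exact: mE|by apply/eqP; rewrite -disj_set2E].
  rewrite /E /E0 /E1 !prE !pr_rcons; case: (P F) => [f| |]//; rewrite -!EFinD => -[].
  by move=> prs; congr _%:E; lra.
have IF : (0 <= \int[P]_(w in F) (grid_functional i.+1 r w)%:E <=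
    (pr s * (1 - (p 0 + p 1)))%:E)%E.
  rewrite integral_ge0//= -PF -[leRHS]mul1e -(integral_cst P mF).
  apply: ge0_le_integral => // w _.
  by rewrite lee_fin grid_functional_le1.
rewrite EU (ge0_integral_setU P mU mF (@mG _ _ _) (fun w _ => G0 w) dF).
rewrite (ge0_integral_setU P (mE _) (mE _) (@mG _ _ _) (fun w _ => G0 w) dE).
have := IH (rcons s 1); have := IH (rcons s 0).
rewrite !size_rcons !sumn_rcons addn0 addn1 !pr_rcons -/i -/E0 -/E1.
have := @one_step_upper R theta h (c (sumn s)) C (V (sumn s)) (V (sumn s).+1).
have := @one_step_lower R theta h (c (sumn s)) C (V (sumn s)) (V (sumn s).+1).
have VV := exit_transform_rec theta_gt0 c_ge0 ms.
have Vge := exit_transform_ge0 m theta_gt0 c_ge0 (sumn s).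
have Vle := exit_transform_le1 m theta_gt0 c_ge0 (sumn s).
have rE : 0 <= r%:R * eps by rewrite mulr_ge0.
move=> /(_ theta_gt0 h_gt0 (c_ge0 _) (c_le _) Vge Vle VV _ rE) lo.
move=> /(_ theta_gt0 h_gt0 (c_ge0 _) (c_le _) Vge VV _ rE) up.
move: IF => /andP[F0 F1] /andP[I0 I0'] /andP[I1 I1'].
have -> : r.+1%:R * eps = r%:R * eps + eps by rewrite -addn1 natrD; ring.
apply/andP; split.
- apply: (@le_trans _ _ (u%:E * ((pr s * p 0 * (V (sumn s) - r%:R * eps))%:E +
     (pr s * p 1 * (V (sumn s).+1 - r%:R * eps))%:E + 0%:E))%E).
    rewrite -!EFinD -EFinM lee_fin.
    apply: le_trans (ler_wpM2l (pr_ge0 s) lo) _.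
    by rewrite -/u; lra.
  by rewrite lee_wpmul2l ?lee_fin ?expR_ge0// !leeD.
- apply: (@le_trans _ _ (u%:E * ((pr s * p 0 * (V (sumn s) + r%:R * eps))%:E +
     (pr s * p 1 * (V (sumn s).+1 + r%:R * eps))%:E +
     (pr s * (1 - (p 0 + p 1)))%:E))%E).
    by rewrite lee_wpmul2l ?lee_fin ?expR_ge0// !leeD.
  rewrite -!EFinD -EFinM lee_fin.
  apply: le_trans (ler_wpM2l (pr_ge0 s) up).
  by rewrite -/u; lra.
Qed.

End grid_functional.

End increments.

(** * From the grid to the joint Laplace transform *)

Section joint_laplace.
Context d (T : measurableType d) (R : realType) (P : probability T R).
Context (theta : R) (N : R -> {RV P >-> nat}).
Hypotheses (theta_gt0 : 0 < theta) (hN : poisson_process theta N).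

Lemma measurable_count_lt t m : measurable [set w | (N t w < m)%N].
Proof.
rewrite -[X in measurable X]setTI.
exact: (@measurable_funPT _ _ _ _ (N t) measurableT [set k | (k < m)%N] I).
Qed.

(** Each value [k < m] has probability at most [k.+1%:R / (theta * t)], and these numerators sum to
    at most the square of [m]. *)
Lemma probability_count_lt t m : 0 < t ->
  (P [set w | (N t w < m)%N] <= (m%:R ^+ 2 / (theta * t))%:E)%E.
Proof.
move=> t0; have tt : 0 < theta * t by exact: mulr_gt0.
elim: m => [|m IH].
  rewrite (_ : [set w | _] = set0) ?measure0 ?expr0n ?mul0r//.
  by apply/seteqP; split.
have -> : [set w | (N t w < m.+1)%N] =
    [set w | (N t w < m)%N] `|` increment N 0 t @^-1` [set m].
  apply/seteqP; split => w /=; rewrite /increment (pp_zero hN) subn0 ltnS.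
    by rewrite leq_eqVlt => /predU1P[]; [right|left].
  by case=> [/ltnW|->].
apply: (le_trans (measureU2 _ _ _)).
- exact: measurable_count_lt.
- exact: measurable_increment.
apply: (le_trans (leeD2r _ IH)).
rewrite [X in (_ + X)%E](pp_poisson_increments hN)// subr0 -EFinD lee_fin.
apply: (le_trans (lerD (lexx _) (poisson_pmf_le m tt))).
rewrite -mulrDl ler_wpM2r ?invr_ge0 ?(ltW tt)//.
by rewrite -(natr1 m); have : 0 <= m%:R :> R by []; nra.
Qed.

Context (x : R) (m : nat).
Hypotheses (m_gt0 : (0 < m)%N) (mP : forall j : nat, (x <= j%:R) = (m <= j)%N).
Context (l1 l2 : R).
Hypotheses (l1_gt0 : 0 < l1) (l2_gt0 : 0 < l2).

Local Notation c := (cost_rate x m l1 l2).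
Let N_nd w s t (s0 : 0 <= s) (st : s <= t) : (N s w <= N t w)%N :=
  pp_nondecreasing hN w s0 st.
Let N_0 w : N 0 w = 0%N := pp_zero hN w.

Let integrand w := expeR (- (l1%:E * passage_time N x w) - l2%:E * passage_area N x w).

Let integrand_le1 w : (integrand w <= 1)%E.
Proof.
rewrite -expeR0 lee_expeR.
have tau0 := passage_time_ge0 N x w.
have area0 := passage_area_ge0 (N_0 w) (@N_nd w) m_gt0 mP.
by rewrite sube_le0 (@le_trans _ _ 0%E)// ?oppe_le0 mule_ge0// lee_fin ltW.
Qed.

Let riemann h M w := h * \sum_(l < M) c (N (l%:R * h) w).

(** The exact cost lies between the right and left Riemann sums, which differ by at most [h * c 0];
    exponentiating yields the factor [expR (h * c 0)]. *)
Let integrand_bounds h M w : 0 <= h -> (m <= N (M%:R * h) w)%N ->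
  ((expR (- riemann h M w))%:E <= integrand w <=
    (expR (h * c 0) * expR (- riemann h M w))%:E)%E.
Proof.
move=> h0 mN.
have Mh : 0 <= M%:R * h by rewrite mulr_ge0.
pose f t := c (N (Num.max 0 t) w).
have fE (l : nat) : f (l%:R * h) = c (N (l%:R * h) w) by rewrite /f max_r// mulr_ge0.
have f_ge0 t : 0 <= f t by exact: cost_rate_ge0.
have f_ni : nonincreasing_fun f.
  move=> s t st; apply: cost_rate_ni => //; apply: N_nd; first by rewrite le_max lexx.
  by rewrite ge_max !le_max lexx st orbT.
have /= costE := passage_costE (N_0 w) (@N_nd w) m_gt0 mP l1_gt0 l2_gt0 Mh mN.
have sumE : \sum_(l < M) f (l%:R * h) = \sum_(l < M) c (N (l%:R * h) w).
  by apply: eq_bigr => l _; exact: fE.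
have /andP[] := nonincreasing_riemann_sum f_ni f_ge0 M h0.
rewrite -costE sumE -/(riemann h M w).
(* Shifting the index changes only the two end terms, and the one at time 0 is [h * c 0] because no
   jump has occurred yet. *)
have -> : h * \sum_(l < M) f (l.+1%:R * h) =
    riemann h M w + h * f (M%:R * h) - h * c 0.
  rewrite /riemann -mulrDr -mulrBr; congr (_ * _).
  apply/eqP; rewrite eq_sym subr_eq; apply/eqP.
  rewrite -sumE -(big_ord_recr M (fun l : 'I_M.+1 => f (l%:R * h)) (op := +%R)).
  by rewrite big_ord_recl/= mul0r {1}/f max_l// N_0 addrC.
have := passage_time_ge0 N x w; have := passage_time_le (N_0 w) m_gt0 mP Mh mN.
have := passage_area_ge0 (N_0 w) (@N_nd w) m_gt0 mP.
rewrite /integrand.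
case: (passage_time N x w) => [tau| |]//; case: (passage_area N x w) => [A| |]//; last first.
  by move=> _ _ _ _; rewrite gt0_muley ?lte_fin// addey// leye_eq.
move=> _ _ _; rewrite -!EFinM -EFinD !lee_fin => lo up.
rewrite -expRD !ler_expR.
have := mulr_ge0 h0 (f_ge0 (M%:R * h)); lra.
Qed.

Local Notation V0 := (exit_transform theta c m 0).
Local Notation eps h := (((theta + c 0) * h) ^+ 2).

Let c_ge0 j : 0 <= c j. Proof. exact: cost_rate_ge0. Qed.
Let c_le j : c j <= c 0. Proof. exact: cost_rate_ni. Qed.
Let c_out j : (m <= j)%N -> c j = 0.
Proof. by rewrite /cost_rate ltnNge => ->. Qed.

Local Notation L := (joint_laplace N x l1 l2).

Let integrand_ge0 w : (0 <= integrand w)%E. Proof. exact: expeR_ge0. Qed.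

(** On [G] the level may not be reached by the horizon, but both integrands lie in the unit
    interval, so [G] contributes at most [q]. Off [G] the exit transform is 1 and [g] is the
    exponential of minus the Riemann sum. *)
Lemma joint_laplace_grid_bounds (h : R) (M : nat) : 0 < h -> (0 < M)%N ->
  let q := m%:R ^+ 2 / (theta * (M%:R * h)) in
  ((V0 - M%:R * eps h - q)%:E <= L)%E /\
  (L <= (expR (h * c 0) * (V0 + M%:R * eps h) + q)%:E)%E.
Proof.
move=> h0 M0 q; have Mh : 0 < M%:R * h by rewrite mulr_gt0// ltr0n.
pose g w := grid_functional theta N h c m 0 M w.
pose G := [set w | (N (M%:R * h) w < m)%N].
have mG : measurable G by exact: measurable_count_lt.
have mCG : measurable (~` G) by exact: measurableC.
have mg (D : set T) : measurable_fun D (fun w => (g w)%:E).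
  by apply/measurable_EFinP/measurable_funTS; exact: measurable_grid_functional.
have g0 w : (0 <= (g w)%:E)%E by rewrite lee_fin grid_functional_ge0.
have PG : (P G <= q%:E)%E by exact: probability_count_lt.
have gE w : ~ G w -> g w = expR (- riemann h M w).
  move=> /negP; rewrite -leqNgt => mN.
  by rewrite /g /grid_functional add0n exit_transform_out// mulr1 big_mkord.
have /andP[lo up] := integral_grid_functional theta_gt0 hN h0 c_ge0 c_le c_out [::] M.
move: lo up; rewrite big_nil !mul1r /=.
(* The empty word imposes no condition, so the conditional estimate becomes one for the full
   mean. *)
have -> : grid_increments N h [::] = setT by apply/seteqP; split.
rewrite -/g => lo up; split.
- rewrite EFinB leeBlDr//; apply: (le_trans lo).
  rewrite -(setUv G) (ge0_integral_setU P mG mCG (@mg _) (fun w _ => g0 w)); last first.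
    exact/disj_setPCl.
  rewrite addeC; apply: leeD; last first.
    apply: le_trans PG; rewrite -[leRHS]mul1e -(integral_cst P mG).
    by apply: ge0_le_integral => // w _; rewrite lee_fin grid_functional_le1.
  (* Extending [g] by 0 outside the complement of [G] permits a comparison on the whole space, so
     that the integral of [integrand] need not be split. *)
  rewrite integral_mkcond; apply: ge0_le_integralT => w.
    by apply: erestrict_ge0 => t _; exact: g0.
  rewrite patchE; case: ifPn => [/[!inE] nG|_]; last exact: integrand_ge0.
  rewrite gE//; have /negP := nG; rewrite -leqNgt => mN.
  by have /andP[] := integrand_bounds (ltW h0) mN.
- have k0 : 0 <= expR (h * c 0) by exact: expR_ge0.
  apply: (@le_trans _ _
      (\int[P]_w ((expR (h * c 0))%:E * (g w)%:E + (\1_G w)%:E))%E).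
    apply: ge0_le_integralT => // w; have [Gw|nGw] := pselect (G w).
      rewrite indicE mem_set//; apply: (le_trans (integrand_le1 w)).
      by rewrite leeDr// mule_ge0.
    rewrite indicE memNset// adde0 gE//; have /negP := nGw; rewrite -leqNgt => mN.
    by have /andP[] := integrand_bounds (ltW h0) mN.
  rewrite ge0_integralD//; last 3 first.
  - by move=> w _; rewrite mule_ge0.
  - exact: measurable_funeM.
  - by apply/measurable_EFinP; exact: measurable_indic.
  rewrite ge0_integralZl_EFin// integral_indic// setIT.
  by rewrite EFinD EFinM leeD// lee_wpmul2l// lee_fin.
Qed.

Lemma joint_laplaceE : L = V0%:E.
Proof.
pose K := (theta + c 0) ^+ 2; pose D := m%:R ^+ 2 / theta.
have bounds (n : nat) : let y := n.+1%:R^-1 in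
  ((V0 - (K + D) * y)%:E <= L)%E /\
  (L <= (expR (c 0 * y ^+ 2) * (V0 + K * y) + D * y)%:E)%E.
  move=> y; have y0 : 0 < y by rewrite invr_gt0.
  have ny : n.+1%:R * y = 1 by rewrite mulfV.
  (* With [n.+1 ^ 3] steps of mesh [y ^+ 2] the horizon is [n.+1]; the accumulated error is then
     [K * y] and the tail bound is [D * y]. *)
  have [||lo up] := @joint_laplace_grid_bounds (y ^+ 2) (n.+1 ^ 3)%N.
  - by rewrite exprn_gt0.
  - by rewrite expn_gt0.
  have nE : (n.+1 ^ 3)%N%:R * y ^+ 2 = n.+1%:R.
    rewrite natrX; have -> : n.+1%:R ^+ 3 * y ^+ 2 = n.+1%:R * (n.+1%:R * y) ^+ 2 by ring.
    by rewrite ny expr1n mulr1.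
  have epsE : (n.+1 ^ 3)%N%:R * eps (y ^+ 2) = K * y.
    have -> : (n.+1 ^ 3)%N%:R * eps (y ^+ 2) = K * ((n.+1 ^ 3)%N%:R * y ^+ 2) * y ^+ 2.
      by rewrite /K; ring.
    by rewrite nE expr2 -mulrA (mulrA _ y) ny mul1r.
  have qE : m%:R ^+ 2 / (theta * ((n.+1 ^ 3)%N%:R * y ^+ 2)) = D * y.
    by rewrite nE invfM mulrA.
  move: lo up; rewrite epsE qE (mulrC (y ^+ 2)) => lo up; split => //.
  by apply: le_trans lo; rewrite lee_fin; lra.
(* One pair of real bounds already shows that [L] is finite, so the limits can be taken in [R]. *)
have [lo0 up0] := bounds 0%N.
have Lfin : L \is a fin_num.
  by rewrite fin_numE -ltNye -ltey (lt_le_trans _ lo0) ?ltNyr// (le_lt_trans up0) ?ltry.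
rewrite -(fineK Lfin); congr _%:E; apply/eqP; rewrite eq_le.
have cvg_poly (a b : R) : (fun n => a + b * harmonic n) @ \oo --> a.
  rewrite -[X in _ --> X]addr0 -[X in _ + X](mulr0 b).
  apply: cvgD; first exact: cvg_cst.
  by apply: cvgM; [exact: cvg_cst|exact: cvg_harmonic].
apply/andP; split.
- have cvg_up : (fun n => expR (c 0 * harmonic n ^+ 2) * (V0 + K * harmonic n) +
      D * harmonic n) @ \oo --> V0.
    rewrite -[X in _ --> X]addr0 -[V0 in X in _ --> X]mul1r -[X in _ + X](mulr0 D).
    apply: cvgD; last by apply: cvgM; [exact: cvg_cst|exact: cvg_harmonic].
    apply: cvgM; last exact: cvg_poly.
    rewrite -(@expR0 R); apply: continuous_cvg; first exact: continuous_expR.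
    rewrite -(mulr0 (c 0)); apply: cvgM; first exact: cvg_cst.
    rewrite -(mulr0 0); under eq_fun do rewrite expr2.
    by apply: cvgM; exact: cvg_harmonic.
  apply: (cvgr_to_ge cvg_up); near=> n.
  by have [_] := bounds n; rewrite -(fineK Lfin) lee_fin.
- apply: (cvgr_to_le (cvg_poly V0 (- (K + D)))); near=> n.
  by have [+ _] := bounds n; rewrite -(fineK Lfin) lee_fin mulNr.
Unshelve. all: by end_near.
Qed.

End joint_laplace.

(** * The product formulas for integer and non-integer [x] *)

Lemma exit_transform_cost_rateE (R : realType) (theta x l1 l2 : R) (m : nat) :
  exit_transform theta (cost_rate x m l1 l2) m 0 =
  theta ^+ m * \prod_(0 <= k < m) (l1 + l2 * (x - k%:R) + theta)^-1.
Proof.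
rewrite /exit_transform big_split/= prodr_const_nat subn0; congr (_ * _).
by rewrite !big_nat; apply: eq_bigr => k /andP[_ km]; rewrite /cost_rate km.
Qed.

Theorem mainTheorem3 (d : measure_display) (T : measurableType d)
    (R : realType) (P : probability T R) (theta : R)
    (N : R -> {RV P >-> nat}) (x : R)
    (htheta : 0 < theta) (hN : poisson_process theta N) (hx : 0 < x)
    (l1 l2 : R) (hl1 : 0 < l1) (hl2 : 0 < l2) :
  (forall n : nat, x = n%:R ->
     joint_laplace N x l1 l2 =
     (theta ^+ n * \prod_(1 <= k < n.+1) (l1 + l2 * k%:R + theta)^-1)%:E)
  /\
  (x \isn't a Num.int ->
     joint_laplace N x l1 l2 =
     (theta ^+ (Num.truncn x).+1 *
        \prod_(0 <= k < (Num.truncn x).+1)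
          (l1 + l2 * (x - k%:R) + theta)^-1)%:E).
Proof.
split=> [n xn|xnint].
- have n_gt0 : (0 < n)%N by rewrite -(ltr0n R) -xn.
  rewrite (joint_laplaceE htheta hN n_gt0 _ hl1 hl2); last first.
    by move=> j; rewrite xn ler_nat.
  rewrite exit_transform_cost_rateE; congr (_ * _)%:E.
  (* Reversing the factors turns the remaining levels [n - k], for [k] from 0 to [n - 1], into 1 up
     to [n]. *)
  rewrite big_nat_rev big_add1/= !big_nat; apply: eq_bigr => k /andP[_ kn].
  by rewrite add0n xn -natrB ?leq_subr// subKn.
- rewrite (joint_laplaceE htheta hN (ltn0Sn (Num.truncn x)) _ hl1 hl2); last first.
    (* Non-integrality rules out [x = j%:R], so [x <= j%:R] is the strict inequality and the ceiling
       is one more than the integer part. *)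
    move=> j; rewrite truncn_lt_nat ?(ltW hx)// le_eqVlt.
    by case: eqP => // xj; move: xnint; rewrite xj natr_int.
  by rewrite exit_transform_cost_rateE.
Qed.
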